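(* For every tree $T$, $b_L(T)\le b(T)$.
   Context: For a finite simple graph $H$, a burning sequence is a sequence $(b_1,\dots,b_t)$ of vertices such that every vertex $v$ satisfies $d_H(v,b_i)\le t-i$ for some $i\in\{1,\dots,t\}$; $b(H)$ is the minimum length of a burning sequence. The line graph $L(G)$ has vertex set $E(G)$, two vertices adjacent iff the edges share an endpoint. The edge burning number of $G$ is $b_L(G)=b(L(G))$. *)

(* Defs.v *)
From mathcomp Require Import all_boot.

Set Implicit Arguments.
Unset Strict Implicit.
Unset Printing Implicit Defensive.

Record sgraph := SGraph {
  vertex :> finType;
  adj : rel vertex;
  adj_sym : symmetric adj;
  adj_irrefl : irreflexive adj }.

Arguments adj {G} : rename.

Section Graph.
Variable G : sgraph.
Implicit Types x y v : G.

Definition walk x y (k : nat) : bool :=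
  [exists p : k.-tuple G, path adj x p && (last x p == y)].

Lemma connect_walk x y : connect adj x y -> exists k, walk x y k.
Proof.
case/connectP=> p pth ->; exists (size p).
by apply/existsP; exists (in_tuple p); rewrite pth eqxx.
Qed.

(* None stands for infinite distance (x and y in different components). *)
Definition dist x y : option nat :=
  if @idP (connect adj x y) is ReflectT c then Some (ex_minn (connect_walk c))
  else None.

Definition dist_le x y (r : nat) : bool :=
  if dist x y is Some d then d <= r else false.

(* The entries of b are indexed from 0: tnth b i is the term b_(i+1). *)
Definition burning (t : nat) (b : t.-tuple G) : bool :=
  [forall v, [exists i : 'I_t, dist_le v (tnth b i) (t - i.+1)]].

Definition burnable (t : nat) : bool := [exists b : t.-tuple G, burning b].

Lemma dist_lexx x r : dist_le x x r.
Proof.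
rewrite /dist_le /dist; case: {-}_ / idP => [c|]; last by rewrite connect0.
case: ex_minnP => m _ /(_ 0) min_m; apply: leq_trans (min_m _) _ => //.
by apply/existsP; exists [tuple]; rewrite /= eqxx.
Qed.

Lemma ex_burnable : exists t, burnable t.
Proof.
exists #|G|; apply/existsP; exists (enum_tuple G); apply/forallP => v.
apply/existsP; exists (enum_rank v).
have -> : tnth (enum_tuple G) (enum_rank v) = v.
  by rewrite (tnth_nth v) /= nth_enum_rank.
exact: dist_lexx.
Qed.

Definition burning_number : nat := ex_minn ex_burnable.

Definition edges : {set {set G}} :=
  [set e : {set G} | [exists x, exists y, adj x y && (e == [set x; y])]].

Definition edge : finType := {e : {set G} | e \in edges}.

Definition ladj : rel edge :=
  [rel e f : edge | (e != f) && (val e :&: val f != set0)].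

Lemma ladj_sym : symmetric ladj.
Proof. by move=> e f; rewrite /ladj /= eq_sym setIC. Qed.

Lemma ladj_irrefl : irreflexive ladj.
Proof. by move=> e; rewrite /ladj /= eqxx. Qed.

Definition line_graph : sgraph := SGraph ladj_sym ladj_irrefl.

Definition connected : Prop := 0 < #|G| /\ forall x y, connect adj x y.

(* Cycles have length at least 3; ucycle is also true of [:: x; y] when x and
   y are adjacent. *)
Definition acyclic : Prop := forall c : seq G, 2 < size c -> ~ ucycle adj c.

Definition tree : Prop := connected /\ acyclic.

End Graph.

Definition edge_burning_number (G : sgraph) : nat :=
  burning_number (line_graph G).

(* Main.v *)
Require Import Defs.
From mathcomp Require Import all_boot.

(** Root the tree and send each vertex to the edge joining it to its parent
    (the root goes to any of its edges). This map is onto the edges, and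
    adjacent vertices go to edges that share an endpoint, so it does not
    increase distances; the image of a burning sequence of the tree is therefore
    a burning sequence of its line graph. *)

(** Trades the minimum inside [dist] for an arbitrary walk of length at most [r], so that later
    arguments only have to exhibit walks. *)
Lemma dist_leP (G : sgraph) (x y : G) (r : nat) :
  reflect (exists p : seq G, [/\ path adj x p, last x p = y & size p <= r])
          (dist_le x y r).
Proof.
rewrite /dist_le /dist; case: {-}_ / idP => [c|nc]; last first.
  by right=> -[p [pp lp _]]; case: nc; apply/connectP; exists p.
case: ex_minnP => m walk_m min_m.
apply: (iffP idP) => [le_mr | [q [pq lq le_qr]]].
  have /existsP[p /andP[pp /eqP lp]] := walk_m.
  by exists p; split=> //; rewrite size_tuple.
apply: leq_trans le_qr; apply: min_m; apply/existsP.
by exists (in_tuple q); rewrite /= pq lq eqxx.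
Qed.

Section Contraction.
Variables (G H : sgraph) (f : G -> H).
Hypothesis f_adj : forall x y, adj x y -> (f x == f y) || adj (f x) (f y).

(** A walk is mapped step by step; a step whose two ends have the same image is dropped, which only
    shortens the walk. *)
Lemma contraction_dist_le x y r : dist_le x y r -> dist_le (f x) (f y) r.
Proof.
case/dist_leP=> p [pp <- {y}]; elim: p x r pp => [|z p IHp] x r /=.
  by move=> _ _; apply: dist_lexx.
case/andP=> xz pp; case: r => // r le_pr.
have /dist_leP[q [pq lq le_qr]] := IHp _ _ pp le_pr.
apply/dist_leP; case/orP: (f_adj _ _ xz) => [/eqP-> | fxz].
  by exists q; split=> //; apply: leqW.
by exists (f z :: q); rewrite /= fxz.
Qed.

Lemma contraction_burning_number :
  (forall z, exists x, f x = z) -> burning_number H <= burning_number G.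
Proof.
move=> f_onto; rewrite {2}/burning_number.
case: ex_minnP => t /existsP[b /forallP burn_b] _.
rewrite /burning_number; case: ex_minnP => m _; apply.
apply/existsP; exists (map_tuple f b); apply/forallP => z.
have [x <-] := f_onto z; have /existsP[i dxi] := burn_b x.
by apply/existsP; exists i; rewrite tnth_map; apply: contraction_dist_le.
Qed.

End Contraction.

Section Parent.
Variable T : sgraph.
Implicit Types (r u v w x y : T).

Definition adj_avoiding v : rel T :=
  [rel x y | [&& adj x y, x != v & y != v]].

Lemma adj_avoiding_sym v : symmetric (adj_avoiding v).
Proof. by move=> x y; rewrite /adj_avoiding /= adj_sym [(x != v) && _]andbC. Qed.

(** The empty path uses no step, so it puts no condition on its start [w]; hence the exception. *)
Lemma path_avoiding v w p :
  path (adj_avoiding v) w p = path adj w p && ((p == [::]) || (v \notin w :: p)).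
Proof.
elim: p w => //= z p IHp w; rewrite IHp /adj_avoiding /= !inE !negb_or.
rewrite ![v == _]eq_sym.
case: p {IHp} => [|y p] /=; first by rewrite !andbT.
rewrite inE negb_or [v == _]eq_sym.
case: (adj w z); case: (adj z y); case: (path _ _ _); case: (w == v);
  by case: (z == v); case: (y == v).
Qed.

(** Otherwise a simple path from [w] to [w'] that misses [v] would close up through [v] into a cycle
    of length at least 3. *)
Lemma acyclic_neighbor_inj v w w' : acyclic T -> adj v w -> adj v w' ->
  connect (adj_avoiding v) w w' -> w = w'.
Proof.
move=> acT vw vw' /connectP[q pq lq].
case/shortenP: pq lq => p pp up _ lp.
case: p pp up lp => [//|z p] pp up lp.
case: (acT (v :: w :: z :: p)) => //; move: pp; rewrite path_avoiding.
case/andP=> pp /= nvp; rewrite /ucycle (cons_uniq v) nvp up.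
by rewrite /= in pp lp *; rewrite rcons_path vw -lp [adj w' v]adj_sym vw' !andbT.
Qed.

(* The parent of v in the tree rooted at r is its neighbor on the side of r. *)
Definition is_parent r v w := adj v w && connect (adj_avoiding v) w r.

Lemma is_parent_inj r v w w' :
  acyclic T -> is_parent r v w -> is_parent r v w' -> w = w'.
Proof.
move=> acT /andP[vw cw] /andP[vw' cw']; apply: (acyclic_neighbor_inj v) => //.
apply: connect_trans cw _.
by rewrite (sym_connect_sym (adj_avoiding_sym v)).
Qed.

(** Follow a simple path from [u] to [r]. If it misses [v], then [u] is the parent of [v]; if it
    meets [v], the part after [v] misses [u], so [v] is the parent of [u]. *)
Lemma adj_is_parent r u v :
  connected T -> adj u v -> is_parent r u v || is_parent r v u.
Proof.
case=> _ cT uv; rewrite /is_parent uv adj_sym uv /=.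
have /connectP[q pq lq] := cT u r.
case/shortenP: pq lq => p pp up _ lp.
have [vp|nvp] := boolP (v \in p); last first.
  apply/orP; right; apply/connectP; exists p => //.
  rewrite path_avoiding pp inE negb_or nvp andbT.
  by rewrite (contraTneq _ uv) ?orbT // => ->; rewrite adj_irrefl.
apply/orP; left; case/splitPr: vp pp up lp => p1 p2.
rewrite cat_path last_cat /= mem_cat negb_or => /and3P[_ _ pp2] /andP[].
case/andP=> _ nup _ ->; apply/connectP; exists p2 => //.
by rewrite path_avoiding pp2 nup orbT.
Qed.

Lemma connected_neighbor x y v : connected T -> adj x y -> exists w, adj v w.
Proof.
case=> _ cT xy; have /connectP[[|w p] /=] := cT v x.
  by move=> _ <-; exists y.
by case/andP=> vw _ _; exists w.
Qed.

Lemma edge_in u v : adj u v -> [set u; v] \in edges T.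
Proof.
move=> uv; rewrite inE.
by apply/existsP; exists u; apply/existsP; exists v; rewrite uv eqxx.
Qed.

Lemma edgeP (e : edge T) : exists u v, adj u v /\ val e = [set u; v].
Proof.
case: e => e /=; rewrite inE => /existsP[u /existsP[v /andP[uv /eqP->]]].
by exists u, v.
Qed.

(** The second clause serves twice: it makes the edges assigned to adjacent vertices meet, and it
    shows that every edge is assigned to a vertex. *)
Lemma ex_parent_function r x y : tree T -> adj x y ->
  exists p : T -> T, (forall v, adj v (p v)) /\
    (forall u v, adj u v -> p u = v \/ p v = u).
Proof.
case=> coT acT xy.
have nbr v : exists w, adj v w by apply: connected_neighbor xy.
(* Only the root has no parent; the default gives it an arbitrary neighbor. *)
pose p v := odflt (xchoose (nbr v)) [pick w | is_parent r v w].
have pE v w : is_parent r v w -> p v = w.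
  rewrite /p; case: pickP => [w' | /(_ w) -> //] pw' pw.
  exact: is_parent_inj pw' pw.
exists p; split=> [v | u v uv].
  rewrite /p; case: pickP => [w /andP[] // | _]; exact: (xchooseP (nbr v)).
by case/orP: (adj_is_parent r _ _ coT uv) => /pE; [left | right].
Qed.

End Parent.

Theorem theorem6 (T : sgraph) (hT : tree T) :
  edge_burning_number T <= burning_number T.
Proof.
rewrite /edge_burning_number.
have [e0 _ | noedge] := pickP (xpredT : pred (edge T)); last first.
  (* Without edges the line graph has no vertices, and the empty sequence burns it. *)
  rewrite /burning_number; case: ex_minnP => m _ min_m.
  apply: leq_trans (min_m 0 _) _ => //; apply/existsP; exists [tuple].
  by apply/forallP => e; have := noedge e.
have [x [y [xy _]]] := edgeP _ e0.
have [p [p_adj p_edge]] := ex_parent_function _ x _ _ hT xy.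
pose f v : line_graph T := Sub [set v; p v] (edge_in _ _ _ (p_adj v)).
apply: (contraction_burning_number _ _ f) => [u v uv | e].
  rewrite /= /ladj /=; case: eqP => //= _; apply/set0Pn.
  (* Whichever of [u] and [v] is the image of the other under [p] lies in both edges. *)
  by case: (p_edge _ _ uv) => <-; [exists (p u) | exists (p v)];
     rewrite !inE eqxx ?orbT.
have [u [v [uv eE]]] := edgeP _ e.
by case: (p_edge _ _ uv) => pE; [exists u | exists v]; apply: val_inj;
   rewrite /= pE eE // setUC.
Qed.
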